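(* Let $\mathcal{L}$ be a language and let $\mathfrak{A}=(A,\mathcal{F})$ be an $\mathcal{L}$-algebra. The following are equivalent. (1) $\mathfrak{A}$ is a Ramsey algebra. (2) For every $\vec{a}\in{}^{\omega}\!A$, the orderly $\mathcal{L}$-algebra $\mathfrak{A}_{\vec{a}}$ induced from $\mathfrak{A}$ by $\vec{a}$ is Ramsey. (3) For every $\vec{a}\in{}^{\omega}\!A$, the orderly $\mathcal{L}$-algebra $\mathfrak{A}_{\vec{a}}$ induced from $\mathfrak{A}$ by $\vec{a}$ is weakly Ramsey.
   Context: $\omega$ is the set of natural numbers (including $0$); ${}^{\omega}\!A$ is the set of infinite sequences in $A$. A language $\mathcal{L}$ is a set of function symbols, each of some arity $n\ge 1$ (no nullary symbols, no relation symbols). Fix variables $v_0,v_1,v_2,\dots$; the index of $v_i$ is $i$. Terms are built from variables and function symbols in the usual way and are written in prefix notation $ft_1\cdots t_n$. An $\mathcal{L}$-algebra $\mathfrak{A}=(A,\mathcal{F})$ is a nonempty set $A$ (its universe) with an interpretation $f^{\mathfrak{A}}:A^n\to A$ of each $n$-ary $f\in\mathcal{L}$, and $\mathcal{F}$ is the collection of these operations. For $\vec{a}\in{}^{\omega}\!A$, $t^{\mathfrak{A}}[\vec{a}]$ is the value of the term $t$ in $\mathfrak{A}$ when each $v_i$ is assigned $\vec{a}(i)$. For a collection $\mathcal{F}$ of operations on $A$, $\mathcal{L}_{\mathcal{F}}$ is the language with one symbol for each $f\in\mathcal{F}$, interpreted as $f$. An orderly term of $\mathcal{L}$ is a term in which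 the indices of the variables occurring, read from left to right, are strictly increasing; $\mathrm{OT}(\mathcal{L})$ is the set of orderly terms. For orderly terms, $t<t'$ means that the index of the last variable of $t$ is less than the index of the first variable of $t'$. $\mathrm{Adm}(\mathcal{L})$ is the set of infinite sequences $\vec{t}$ of orderly terms with $\vec{t}(0)<\vec{t}(1)<\vec{t}(2)<\cdots$. For $\vec{a},\vec{b}\in{}^{\omega}\!A$, $\vec{b}\leq_{\mathcal{F}}\vec{a}$ (''$\vec b$ is a reduction of $\vec a$'') means there is $\vec{t}\in\mathrm{Adm}(\mathcal{L}_{\mathcal{F}})$ with $\vec{b}(i)=(\vec{t}(i))^{\mathfrak{A}}[\vec{a}]$ for all $i\in\omega$. $\mathrm{FR}_{\mathcal{F}}(\vec{a})=\{t^{\mathfrak{A}}[\vec{a}] : t\in\mathrm{OT}(\mathcal{L}_{\mathcal{F}})\}$. The algebra $(A,\mathcal{F})$ is Ramsey if for every $\vec{a}\in{}^{\omega}\!A$ and $X\subseteq A$ there is $\vec{b}\leq_{\mathcal{F}}\vec{a}$ such that $\mathrm{FR}_{\mathcal{F}}(\vec{b})$ is either contained in or disjoint from $X$. An orderly $\mathcal{L}$-algebra is a function $\mathscr{A}$ with domain $\mathrm{OT}(\mathcal{L})$ such that for each $n$-ary $f\in\mathcal{L}$: $\mathscr{A}(ft_1\cdots t_n)=\mathscr{A}(ft_1'\cdots t_n')$ whenever $t_1<\cdots<t_n$ and $t_1'<\cdots<t_n'$ are orderly terms with $\mathscr{A}(t_k)=\mathscr{A}(t_k')$ for $1\le k\le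 n$. Its universe $\Vert\mathscr{A}\Vert$ is its range. The orderly $\mathcal{L}$-algebra $\mathfrak{A}_{\vec{a}}$ induced from $\mathfrak{A}$ by $\vec{a}$ is defined by $\mathfrak{A}_{\vec{a}}(t)=t^{\mathfrak{A}}[\vec{a}]$ for all $t\in\mathrm{OT}(\mathcal{L})$. For $s\in\mathrm{OT}(\mathcal{L})$ and $\vec{t}\in\mathrm{Adm}(\mathcal{L})$, $s[\vec{t}]$ is the orderly term obtained by replacing each variable $v_i$ in $s$ by $\vec{t}(i)$. For orderly $\mathcal{L}$-algebras, $\mathscr{B}$ is a reduction of $\mathscr{A}$ if there is $\vec{t}\in\mathrm{Adm}(\mathcal{L})$ with $\mathscr{B}(s)=\mathscr{A}(s[\vec{t}])$ for all $s\in\mathrm{OT}(\mathcal{L})$. $\mathscr{B}$ is homogeneous for $X$ if $\Vert\mathscr{B}\Vert$ is either contained in or disjoint from $X$. $\mathscr{A}$ is weakly Ramsey if for every $X\subseteq\Vert\mathscr{A}\Vert$ there is a reduction of $\mathscr{A}$ homogeneous for $X$. $\mathscr{A}$ is Ramsey if for every reduction $\mathscr{B}$ of $\mathscr{A}$ and every $X\subseteq\Vert\mathscr{A}\Vert$ there is a reduction $\mathscr{C}$ of $\mathscr{B}$ homogeneous for $X$. *)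

(* Defs.v *)
From HB Require Import structures.
From mathcomp Require Import all_boot classical_sets.

Set Implicit Arguments.
Unset Strict Implicit.
Unset Printing Implicit Defensive.

Local Open Scope classical_set_scope.

(* In all this file [T ^ n] is the type [{ffun 'I_n -> T}] of n-tuples. *)

Record language := Language {
  symbol :> Type;
  arity : symbol -> nat;
  arity_gt0 : forall f, 0 < arity f
}.

Unset Elimination Schemes.
Inductive term (L : language) :=
| Var of nat
| App (f : L) of (term L ^ arity f)%type.
Set Elimination Schemes.

Arguments Var {L} i.
Arguments App {L} f ts.

Lemma term_ind (L : language) (P : term L -> Prop) :
  (forall i, P (Var i)) ->
  (forall (f : L) (ts : (term L ^ arity f)%type),
      (forall k, P (ts k)) -> P (App f ts)) ->
  forall t, P t.
Proof. by move=> PV PA; fix IH 1 => -[i|f ts]; [|apply: PA => k; apply: IH]. Qed.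

(* The indices of the variable occurrences of a term, from left to right
   ([codom] lists the arguments in increasing order of position). *)
Fixpoint vars (L : language) (t : term L) : seq nat :=
  match t with
  | Var i => [:: i]
  | App f ts => flatten (codom (fun k => vars (ts k)))
  end.

Definition orderly (L : language) (t : term L) : bool := sorted ltn (vars t).

Record OT (L : language) := OTerm {
  oterm :> term L;
  oterm_orderly : orderly oterm
}.

HB.instance Definition _ L := [isSub for @oterm L].

(* The default value 0 is never used, see [vars_neq0]. *)
Definition term_lt (L : language) (t u : term L) : bool :=
  last 0 (vars t) < head 0 (vars u).

Record Adm (L : language) := AdmSeq {
  adm_fun :> nat -> OT L;
  adm_lt : forall i, term_lt (adm_fun i) (adm_fun i.+1)
}.

Fixpoint term_subst (L : language) (t : nat -> term L) (s : term L) : term L :=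
  match s with
  | Var i => t i
  | App f ss => App f [ffun k => term_subst t (ss k)]
  end.

Section OrderlyTheory.
Variable L : language.
Implicit Types (t u : term L) (s : OT L).

Lemma vars_neq0 t : vars t != [::].
Proof.
elim: t => [i|f ts IH] //=.
have [k _] : exists k : 'I_(arity f), true by exists (Ordinal (arity_gt0 f)).
case E: (vars (ts k)) (IH k) => [//|x r] _.
apply/eqP => F0.
suff : x \in flatten (codom (fun k => vars (ts k))) by rewrite F0.
by apply/flatten_mapP; exists k; rewrite ?mem_enum // E inE eqxx.
Qed.

Lemma orderlyE t : orderly t = pairwise ltn (vars t).
Proof. exact/sorted_pairwise/ltn_trans. Qed.

Lemma term_ltP s s' :
  reflect {in vars s & vars s', forall x y, x < y} (term_lt s s').
Proof.
have ns := vars_neq0 s; have ns' := vars_neq0 s'.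
apply: (iffP idP) => [lt x y xs ys|]; last first.
  apply.
    by case: (vars s) ns => // z r _; rewrite /= mem_last.
  by case: (vars s') ns' => // z r _; rewrite mem_head.
have lex : x <= last 0 (vars s).
  have := oterm_orderly s; rewrite orderlyE.
  case/lastP: (vars s) xs => // r z; rewrite last_rcons mem_rcons inE.
  rewrite pairwise_rcons => /orP[/eqP->//|xr] /andP[/allP/(_ _ xr) + _].
  exact: ltnW.
have ley : head 0 (vars s') <= y.
  have := oterm_orderly s'; rewrite orderlyE.
  case: (vars s') ys => // z r; rewrite inE /=.
  move=> /orP[/eqP->//|yr] /andP[/allP/(_ _ yr) + _]; exact: ltnW.
exact: leq_ltn_trans lex (leq_trans lt ley).
Qed.

Lemma term_lt_trans s1 s2 s3 :
  term_lt s1 s2 -> term_lt s2 s3 -> term_lt s1 s3.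
Proof.
move=> /term_ltP h12 /term_ltP h23; apply/term_ltP => x z xs zs.
case E: (vars s2) (vars_neq0 s2) => [//|y r] _.
have ys : y \in vars s2 by rewrite E mem_head.
exact: ltn_trans (h12 _ _ xs ys) (h23 _ _ ys zs).
Qed.

Lemma adm_lt_mono (t : Adm L) i j : i < j -> term_lt (t i) (t j).
Proof.
elim: j => // j IH; rewrite ltnS leq_eqVlt => /orP[/eqP->|/IH lt].
  exact: adm_lt.
exact: term_lt_trans lt (adm_lt t j).
Qed.

Lemma pairwise_flatten_ltn (ss : seq (seq nat)) :
  all (pairwise ltn) ss -> pairwise (allrel ltn) ss ->
  pairwise ltn (flatten ss).
Proof.
elim: ss => //= r ss IH /andP[pr /IH{}IH] /andP[/allP ar /IH{}IH].
rewrite pairwise_cat pr IH !andbT; apply/allrelP => x y xr /flattenP[r' r's yr'].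
exact: (allrelP (ar _ r's)).
Qed.

Definition increasing n (ts : (OT L ^ n)%type) : Prop :=
  forall i j : 'I_n, i < j -> term_lt (ts i) (ts j).

Lemma orderly_App (f : L) (ts : (OT L ^ arity f)%type) :
  increasing ts -> orderly (App f [ffun k => oterm (ts k)]).
Proof.
move=> inc; rewrite orderlyE /=; apply: pairwise_flatten_ltn.
  apply/allP => _ /codomP[k ->]; rewrite ffunE -orderlyE; exact: oterm_orderly.
rewrite codomE pairwise_map.
have: pairwise ltn (map val (enum 'I_(arity f))).
  rewrite val_enum_ord -(sorted_pairwise ltn_trans); exact: iota_ltn_sorted.
rewrite pairwise_map; apply: sub_pairwise => i j /= lt.
by rewrite !ffunE; apply/allrelP/term_ltP/inc.
Qed.

Lemma vars_subst (t : nat -> term L) u :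
  vars (term_subst t u) = flatten [seq vars (t i) | i <- vars u].
Proof.
elim: u => [i|f us IH] /=; first by rewrite cats0.
rewrite !codomE; elim: (enum _) => //= k r IHr.
by rewrite map_cat flatten_cat -IHr ffunE IH.
Qed.

Lemma orderly_subst (t : Adm L) s : orderly (term_subst (fun i => oterm (t i)) s).
Proof.
rewrite orderlyE vars_subst; apply: pairwise_flatten_ltn.
  apply/allP => _ /mapP[i _ ->]; rewrite -orderlyE; exact: oterm_orderly.
rewrite pairwise_map; have := oterm_orderly s; rewrite orderlyE.
by apply: sub_pairwise => i j /adm_lt_mono lt; apply/allrelP/term_ltP/lt.
Qed.

End OrderlyTheory.

Definition OApp (L : language) (f : L) (ts : (OT L ^ arity f)%type)
    (inc : increasing ts) : OT L :=
  OTerm (orderly_App inc).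

Definition osubst (L : language) (t : Adm L) (s : OT L) : OT L :=
  OTerm (orderly_subst t s).

Record algebra (L : language) := Algebra {
  carrier :> Type;
  carrier_inhabited : inhabited carrier;
  interp : forall f : L, (carrier ^ arity f)%type -> carrier
}.

Arguments interp {L} M f xs : rename.

Fixpoint eval (L : language) (M : algebra L) (a : nat -> M) (t : term L) : M :=
  match t with
  | Var i => a i
  | App f ts => interp M f [ffun k => eval a (ts k)]
  end.

Record operation (A : Type) := Operation {
  op_arity : nat;
  op_arity_gt0 : 0 < op_arity;
  op_fun :> (A ^ op_arity)%type -> A
}.

Arguments op_fun {A} g xs : rename.

(* The collection of the operations of an algebra: distinct symbols with the
   same interpretation contribute a single element. *)
Definition operations (L : language) (M : algebra L) : set (operation M) :=
  range (fun f : L => Operation (arity_gt0 f) (interp M f)).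

Arguments operations {L} M _.

Definition language_of (A : Type) (F : set (operation A)) : language :=
  @Language {g : operation A | F g}
    (fun g => op_arity (sval g)) (fun g => op_arity_gt0 (sval g)).

Definition algebra_of (A : Type) (A0 : inhabited A) (F : set (operation A)) :
    algebra (language_of F) :=
  @Algebra (language_of F) A A0 (fun g => op_fun (sval g)).

Section RamseyAlgebra.
Variables (A : Type) (A0 : inhabited A) (F : set (operation A)).

Definition seq_reduction (b a : nat -> A) : Prop :=
  exists t : Adm (language_of F),
    forall i, b i = @eval _ (algebra_of A0 F) a (t i).

Definition FR (a : nat -> A) : set A :=
  range (fun t : OT (language_of F) => @eval _ (algebra_of A0 F) a t).

Definition is_Ramsey : Prop :=
  forall (a : nat -> A) (X : set A),
    exists2 b, seq_reduction b a & FR b `<=` X \/ FR b `&` X = set0.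

End RamseyAlgebra.

Definition Ramsey_algebra (L : language) (M : algebra L) : Prop :=
  is_Ramsey (carrier_inhabited M) (operations M).

Record orderly_algebra (L : language) (V : Type) := OrderlyAlgebra {
  oalg_fun :> OT L -> V;
  oalg_compat : forall (f : L) (ts ts' : (OT L ^ arity f)%type)
      (inc : increasing ts) (inc' : increasing ts'),
    (forall k, oalg_fun (ts k) = oalg_fun (ts' k)) ->
    oalg_fun (OApp inc) = oalg_fun (OApp inc')
}.

Section OrderlyRamsey.
Variables (L : language) (V : Type).
Implicit Types (A B C : orderly_algebra L V) (X : set V).

Definition universe A : set V := range A.

Definition reduction B A : Prop :=
  exists t : Adm L, forall s, B s = A (osubst t s).

Definition homogeneous B X : Prop :=
  universe B `<=` X \/ universe B `&` X = set0.

Definition weakly_Ramsey A : Prop :=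
  forall X, X `<=` universe A -> exists2 B, reduction B A & homogeneous B X.

Definition orderly_Ramsey A : Prop :=
  forall B X, reduction B A -> X `<=` universe A ->
    exists2 C, reduction C B & homogeneous C X.

End OrderlyRamsey.

Lemma induced_compat (L : language) (M : algebra L) (a : nat -> M)
    (f : L) (ts ts' : (OT L ^ arity f)%type)
    (inc : increasing ts) (inc' : increasing ts') :
  (forall k, eval a (ts k) = eval a (ts' k)) ->
  eval a (OApp inc) = eval a (OApp inc').
Proof.
by move=> eq /=; congr (interp M f _); apply/ffunP => k; rewrite !ffunE.
Qed.

Definition induced (L : language) (M : algebra L) (a : nat -> M) :
    orderly_algebra L M :=
  @OrderlyAlgebra L M (fun t => eval a t) (@induced_compat L M a).

(* Main.v *)
(** The symbols of the language of the operations of [M] are those of [L] up to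
    identification of symbols with equal interpretations, so every orderly term
    over one language has a counterpart over the other with the same variables
    and the same value under every assignment. Hence reductions of sequences and
    the sets [FR] can be computed with terms over [L], and reductions of
    [induced a] are exactly the algebras [induced b] with [b] a reduction of [a]:
    [eval a (osubst t s) = eval b s] when [b i = eval a (t i)]. *)
Require Import Defs.
From mathcomp Require Import all_boot.
From mathcomp Require Import boolp classical_sets.

Set Implicit Arguments.
Unset Strict Implicit.
Unset Printing Implicit Defensive.

Local Open Scope classical_set_scope.

Lemma eval_subst (L : language) (M : algebra L) (a : nat -> M)
    (t : nat -> term L) (s : term L) :
  eval a (term_subst t s) = eval (fun i => eval a (t i)) s.
Proof.
elim: s => [//|f ss IH] /=; congr (interp M f _).
by apply/ffunP => k; rewrite !ffunE IH.
Qed.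

Section Transfer.
Variables (L L' : language) (A : Type) (A0 A0' : inhabited A).
Variable I : forall f : L, (A ^ arity f)%type -> A.
Variable I' : forall f : L', (A ^ arity f)%type -> A.
Let M := Algebra A0 I.
Let N := Algebra A0' I'.
Hypothesis sMN : operations M `<=` operations N.

(* Stated for an arbitrary [g] so that the equation between [g] and the
   interpretation of a symbol can be eliminated without transporting [us]. *)
Lemma operation_term (g : operation A) (us : (term L' ^ op_arity g)%type) :
  operations N g ->
  exists u : term L', vars u = flatten (codom (fun k => vars (us k))) /\
    forall a : nat -> A, @eval _ N a u = g [ffun k => @eval _ N a (us k)].
Proof. by move=> Ng; case: Ng us => f _ <- us; exists (App f us). Qed.

Lemma transfer_term (t : term L) : exists u : term L', vars u = vars t /\
  forall a : nat -> A, @eval _ N a u = @eval _ M a t.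
Proof.
elim: t => [i|f ts IH]; first by exists (Var i).
(* The counterparts of the arguments are fixed before any assignment is given, so one [u] works for
   all [a]. *)
have [us usP] := choice IH.
have [|u [uv ue]] := @operation_term (Operation (arity_gt0 f) (@I f)) (finfun us).
  by apply: sMN; exists f.
exists u; split=> [|a].
  by rewrite uv /=; congr flatten; apply: eq_codom => k; rewrite ffunE (usP k).1.
by rewrite ue /=; congr (@I f _); apply/ffunP => k; rewrite !ffunE (usP k).2.
Qed.

(** Orderliness depends on [vars] alone, hence survives the change of language. *)
Lemma transfer_OT (t : OT L) : exists u : OT L', vars u = vars t /\
  forall a : nat -> A, @eval _ N a u = @eval _ M a t.
Proof.
have [u [uv ue]] := transfer_term t.
have ou : orderly u by rewrite /orderly uv; exact: oterm_orderly.
by exists (OTerm ou).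
Qed.

Lemma transfer_Adm (t : Adm L) : exists u : Adm L', forall i (a : nat -> A),
  @eval _ N a (u i) = @eval _ M a (t i).
Proof.
have [u uP] := choice (fun i => transfer_OT (t i)).
have ltu i : term_lt (u i) (u i.+1).
  by rewrite /term_lt (uP i).1 (uP i.+1).1; exact: adm_lt.
by exists (AdmSeq ltu) => i; case: (uP i).
Qed.

End Transfer.

Arguments transfer_OT {L L' A A0 A0' I I'} sMN t.
Arguments transfer_Adm {L L' A A0 A0' I I'} sMN t.

(** Taken with [F := operations M], this allows transfer in both directions between [L] and the
    language of the operations of [M]. *)
Lemma operations_algebra_of (A : Type) (A0 : inhabited A)
    (F : set (operation A)) : operations (algebra_of A0 F) = F.
Proof.
rewrite eqEsubset; split=> [_ [[[n n0 g] Fg] _ <-] //|[n n0 g] Fg].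
by exists (exist _ _ Fg).
Qed.

Lemma seq_reductionE (L : language) (M : algebra L) (b a : nat -> M) :
  seq_reduction (carrier_inhabited M) (operations M) b a <->
  exists t : Adm L, forall i, b i = eval a (t i).
Proof.
case: M b a => A A0 I b a; set M := Algebra A0 I.
have E := operations_algebra_of A0 (operations M).
split=> -[t tP].
  have [u uP] := transfer_Adm (subsetW E) t.
  by exists u => i; rewrite tP uP.
have [u uP] := transfer_Adm (I := I) (subsetW (esym E)) t.
by exists u => i; rewrite tP uP.
Qed.

Lemma FRE (L : language) (M : algebra L) (a : nat -> M) :
  FR (carrier_inhabited M) (operations M) a = universe (induced a).
Proof.
case: M a => A A0 I a; set M := Algebra A0 I.
have E := operations_algebra_of A0 (operations M).
rewrite eqEsubset; split=> _ [t _ <-].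
  have [u [_ uP]] := transfer_OT (subsetW E) t.
  by exists u => //; rewrite /= uP.
have [u [_ uP]] := transfer_OT (I := I) (subsetW (esym E)) t.
by exists u => //; rewrite uP.
Qed.

Lemma reduction_inducedP (L : language) (M : algebra L) (a : nat -> M)
    (B : orderly_algebra L M) :
  reduction B (induced a) <->
  exists2 b, seq_reduction (carrier_inhabited M) (operations M) b a
           & B =1 induced b.
Proof.
split=> [[t tP]|[b /seq_reductionE[t tP] Bb]].
  exists (fun i => eval a (t i)); first by apply/seq_reductionE; exists t.
  by move=> s; rewrite tP /= eval_subst.
by exists t => s; rewrite Bb /= eval_subst; congr eval; apply/funext.
Qed.

Lemma eq_universe (L : language) (V : Type) (B C : orderly_algebra L V) :
  B =1 C -> universe B = universe C.
Proof. by move=> /funext BC; rewrite /universe BC. Qed.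

Lemma eq_reduction (L : language) (V : Type) (A B C : orderly_algebra L V) :
  A =1 B -> reduction C A -> reduction C B.
Proof. by move=> AB [t tP]; exists t => s; rewrite tP AB. Qed.

Lemma reduction_refl (L : language) (M : algebra L) (a : nat -> M) :
  reduction (induced a) (induced a).
Proof.
have ov i : orderly (@Var L i) by [].
have lv i : term_lt (OTerm (ov i)) (OTerm (ov i.+1)) by rewrite /term_lt /=.
(* The admissible sequence of all variables acts as the identity substitution. *)
by exists (@AdmSeq L (fun i => OTerm (ov i)) lv) => s; rewrite /= eval_subst.
Qed.

Lemma universe_reduction (L : language) (V : Type) (A B : orderly_algebra L V) :
  reduction B A -> universe B `<=` universe A.
Proof. by move=> [t tP] _ [s _ <-]; exists (osubst t s). Qed.

Theorem theorem4p4 (L : language) (M : algebra L) :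
  [<-> Ramsey_algebra M;
       forall a : nat -> M, orderly_Ramsey (induced a);
       forall a : nat -> M, weakly_Ramsey (induced a)].
Proof.
tfae.
- move=> R a B X /reduction_inducedP[b _ Bb] _.
  (* Since [B] is induced by [b], the Ramsey property is applied at [b] rather than at [a]. *)
  have [c cb cX] := R b X; exists (induced c); last first.
    by rewrite /homogeneous -FRE.
  apply: (@eq_reduction _ _ (induced b)) => [s|]; first by rewrite Bb.
  by apply/reduction_inducedP; exists c.
- by move=> R a X; apply: R; exact: reduction_refl.
- move=> R a X.
  (* Weak Ramseyness only handles subsets of the universe, so [X] is first cut down to it. *)
  have [|B Ba BX] := R a (X `&` universe (induced a)); first exact: subIsetr.
  have sBa := universe_reduction Ba.
  have [b ba Bb] := (reduction_inducedP a B).1 Ba.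
  exists b => //; rewrite FRE -(eq_universe Bb).
  case: BX => [|BX]; [by rewrite subsetI => -[]; left|right].
  (* Inside [universe B], the set [X] and its trace on the larger universe coincide. *)
  by rewrite -(setIidl sBa) setIAC -setIA.
Qed.
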